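(* Let $P$ and $Q$ be distributions on $\mathsf Z$ (both given by PMFs if $\mathsf Z$ is discrete, or both given by PDFs if $\mathsf Z$ is continuous). If there exists $\sigma_Q>0$ such that $R_{1-\lambda}(Q)-R_1(Q)\le\lambda\sigma_Q^2/2$ for all $\lambda>0$, then $$H_{\log}(P)-H_{\log}(Q)\le\sqrt{2\sigma_Q^2\,D(P\|Q)}.$$ For the other direction, if there exists $\sigma_P>0$ such that $R_1(Q,P)-R_{1+\lambda}(Q,P)\le\lambda\sigma_P^2/2$ for all $\lambda>0$, then $$H_{\log}(Q)-H_{\log}(P)\le\sqrt{2\sigma_P^2\,D(P\|Q)}.$$
   Context: $H_{\log}(P)=\mathbb E_P[-\log P(Z)]$ is the Shannon entropy (discrete $\mathsf Z$) or differential entropy (continuous $\mathsf Z$), where $P(z)$ is the PMF or PDF; natural logarithms are used. For $\alpha\in\mathbb R\setminus\{1\}$, the Rényi cross entropy between $Q$ and $P$ of order $\alpha$ is $R_\alpha(Q,P)=\frac1{1-\alpha}\log\int_{\mathsf Z}Q(\mathrm dz)P(z)^{\alpha-1}$, and $R_1(Q,P)=-\int_{\mathsf Z}Q(\mathrm dz)\log P(z)$. The Rényi entropy is $R_\alpha(Q)=R_\alpha(Q,Q)$, with $R_1(Q)=H_{\log}(Q)$. The order $\alpha$ may be any real number. $D(P\|Q)$ is the KL divergence. The (cross) entropies of order 1 appearing are assumed to be well defined and finite so that the differences make sense. *)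

(* Defs.v *)
From HB Require Import structures.
From mathcomp Require Import all_boot all_order all_algebra.
From mathcomp Require Import all_classical all_reals all_analysis.

Set Implicit Arguments.
Unset Strict Implicit.
Unset Printing Implicit Defensive.

Import Order.TTheory GRing.Theory Num.Theory.
Import numFieldNormedType.Exports.

Local Open Scope classical_set_scope.
Local Open Scope ring_scope.
Local Open Scope ereal_scope.

Section renyi.
Context (d : measure_display) (Z : measurableType d) (R : realType).
Implicit Types (mu : {measure set Z -> \bar R}) (P Q : probability Z R)
  (p q : Z -> R) (r alpha : R).

(* [mu] is the counting measure for PMFs on a discrete space and Lebesgue
   measure for PDFs; both cases are treated at once by leaving it arbitrary. *)
Definition is_density mu P p : Prop :=
  [/\ measurable_fun setT p, (forall z, (0 <= p z)%R) &
      forall A, measurable A -> P A = \int[mu]_(z in A) (p z)%:E].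

(* x ^ r for x >= 0. The library's powers satisfy 0 `^ r = 0 for r < 0;
   here 0 ^ r = +oo for r < 0, as needed in Renyi cross entropies of order
   less than 1. *)
Definition epow (x : \bar R) r : \bar R := expeR (r%:E * lne x).

(* In the definitions below [p], [q] are densities of [P], [Q], and
   lne 0 = -oo. *)
Definition Hlog P p : \bar R := \int[P]_z (- lne (p z)%:E).

Definition renyi_cross_entropy alpha Q p : \bar R :=
  if alpha == 1%R then - \int[Q]_z lne (p z)%:E
  else ((1 - alpha)^-1)%:E * lne (\int[Q]_z epow (p z)%:E (alpha - 1)%R).

Definition renyi_entropy alpha Q q : \bar R := renyi_cross_entropy alpha Q q.

(* Extended division: a / 0 = +oo for a > 0, hence the value +oo when P is not
   absolutely continuous with respect to Q. The case 0 / 0 is P-null. *)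
Definition KL P p q : \bar R := \int[P]_z lne ((p z)%:E / (q z)%:E).

End renyi.

(* Main.v *)
(* Donsker-Varadhan applied to the test function -l log q gives
   H(P) + D(P||Q) <= D(P||Q) / l + R_{1-l}(Q), and applied to l log p it gives
   -H(P) <= D(P||Q) / l - R_{1+l}(Q,P). The hypotheses bound the Renyi terms, so
   both entropy differences are at most D(P||Q) / l + l sigma^2 / 2 for all
   l > 0; the second one also uses H(Q) <= R_1(Q,P), i.e. Gibbs' inequality.
   Taking l equal to the entropy difference over sigma^2 avoids having to treat
   D(P||Q) = 0 separately. *)
Require Import Defs.
From HB Require Import structures.
From mathcomp Require Import all_boot all_order all_algebra.
From mathcomp Require Import all_classical all_reals all_analysis.
From mathcomp Require Import measurable_realfun.
From mathcomp Require Import ring lra.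

Set Implicit Arguments.
Unset Strict Implicit.
Unset Printing Implicit Defensive.

Import Order.TTheory GRing.Theory Num.Theory.
Import numFieldNormedType.Exports.

Local Open Scope classical_set_scope.
Local Open Scope ring_scope.
Local Open Scope ereal_scope.

(** * Change of measure from [P] to the reference measure *)

Section density.
Context (d : measure_display) (Z : measurableType d) (R : realType).
Implicit Types (mu : {measure set Z -> \bar R}) (P Q : probability Z R)
  (p q f g : Z -> R).

Import HBNNSimple.

(** [is_density] speaks of sets only. Both sides are limits along simple functions increasing to
    [g]; by linearity each reduces to indicators of level sets, where the definition applies. *)
Lemma ge0_integral_density mu P p (g : Z -> \bar R) : is_density mu P p ->
  measurable_fun setT g -> (forall z, 0 <= g z) ->
  \int[P]_z g z = \int[mu]_z (g z * (p z)%:E).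
Proof.
move=> [mp p0 Pp] mg g0; pose h := nnsfun_approx measurableT mg.
have mEp : measurable_fun setT (EFin \o p) by exact/measurable_EFinP.
have mh n : measurable_fun setT (EFin \o h n).
  exact/measurable_EFinP/measurable_funP.
have h_ge0 n z : 0 <= (EFin \o h n) z by rewrite lee_fin.
have h_nd z : {homo (fun n => (EFin \o h n) z) : m n / (m <= n)%N >-> m <= n}.
  by move=> m n mn; rewrite lee_fin; exact/lefP/nd_nnsfun_approx.
have -> : \int[P]_z g z = limn (fun n => \int[P]_z (EFin \o h n) z).
  rewrite -monotone_convergence//.
  by apply: eq_integral => z _; apply/esym/cvg_lim => //; exact: cvg_nnsfun_approx.
have -> : \int[mu]_z (g z * (p z)%:E) =
    limn (fun n => \int[mu]_z ((EFin \o h n) z * (p z)%:E)).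
  rewrite -monotone_convergence//.
  - apply: eq_integral => z _; apply/esym/cvg_lim => //.
    by apply: cvgeZr => //; exact: cvg_nnsfun_approx.
  - by move=> n; exact: emeasurable_funM.
  - by move=> n z _; rewrite mule_ge0// lee_fin.
  - by move=> z _ m n mn; rewrite lee_wpmul2r ?lee_fin//; exact: h_nd.
apply: congr_lim; apply/funext => n.
have mind r : measurable_fun setT (EFin \o \1_(h n @^-1` [set r]) : Z -> \bar R).
  exact/measurable_EFinP.
transitivity (\int[P]_z
    (\sum_(y \in range (h n)) (y%:E * (\1_(h n @^-1` [set y]) z)%:E))).
  by apply: eq_integral => z _; rewrite /= fimfunE -fsumEFin.
transitivity (\int[mu]_z (\sum_(y \in range (h n))
    (y%:E * (\1_(h n @^-1` [set y]) z)%:E * (p z)%:E))); last first.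
  apply: eq_integral => z _.
  rewrite -ge0_mule_fsuml => [|y]; last exact: nnfun_muleindic_ge0.
  by rewrite /= fimfunE -fsumEFin.
rewrite ge0_integral_fsum//; last 2 first.
- by move=> r; apply: measurable_funeM; exact: mind.
- by move=> r z _; exact: nnfun_muleindic_ge0.
rewrite ge0_integral_fsum//; last 2 first.
- by move=> r; apply: emeasurable_funM => //; apply: measurable_funeM; exact: mind.
- by move=> r z _; rewrite mule_ge0 ?lee_fin//; exact: nnfun_muleindic_ge0.
apply: eq_fsbigr => r; rewrite inE => -[t _ <-].
under [RHS]eq_integral do rewrite -muleA.
rewrite !ge0_integralZl ?lee_fin//; last 3 first.
- by apply: emeasurable_funM; [exact: mind|].
- by move=> z _; rewrite mule_ge0// lee_fin.
- exact: mind.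
rewrite integral_indic// setIT; congr (_ * _).
transitivity (\int[mu]_(z in h n @^-1` [set h n t]) (p z)%:E); first exact: Pp.
rewrite -[in LHS](setTI (h n @^-1` _)) integral_mkcondr epatch_indic.
by under [RHS]eq_integral do rewrite muleC.
Qed.

Lemma density_gt0_ae mu P p : is_density mu P p ->
  {ae P, forall z, (0 < p z)%R}.
Proof.
move=> [mp p0 Pp].
have mp0 : measurable [set z | p z = 0%R].
  by rewrite -[X in measurable X]setTI; exact: mp (measurable_set1 0%R).
exists [set z | p z = 0%R]; split => //.
  by rewrite Pp//; apply: integral0_eq => z /= ->.
by move=> z /=; apply: contra_notP => /eqP pz; rewrite lt_neqAle eq_sym pz p0.
Qed.

Lemma measurable_fun_ratio q p : (forall z, 0 <= p z)%R ->
  measurable_fun setT q -> measurable_fun setT p ->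
  measurable_fun setT (fun z => q z / p z)%R.
Proof.
move=> p0 mq mp; apply: measurable_funM => //.
(* On nonnegative reals inversion is the power -1, also at 0, where both give 0. *)
have -> : (fun z => (p z)^-1%R) = (fun z => p z `^ (-1))%R.
  by apply/funext => z; rewrite powR_inv1.
exact: measurableT_comp (@measurable_powR R (-1)%R) mp.
Qed.

(** Against [mu], the factor [p] cancels the denominator where [p > 0] and kills the integrand where
    [p = 0]. Equality can fail because [Q] may charge the zero set of [p]. *)
Lemma integral_density_ratio_le mu P Q p q g :
  is_density mu P p -> is_density mu Q q ->
  measurable_fun setT g -> (forall z, 0 <= g z)%R ->
  \int[P]_z (g z * (q z / p z))%:E <= \int[Q]_z (g z)%:E.
Proof.
move=> hP hQ; have [mp p0 _] := hP; have [mq q0 _] := hQ => mg g0.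
have mr : measurable_fun setT (fun z => (g z * (q z / p z))%:E).
  by apply/measurable_EFinP/measurable_funM => //; exact: measurable_fun_ratio.
rewrite (ge0_integral_density hP)//; last first.
  by move=> z; rewrite lee_fin mulr_ge0// divr_ge0.
rewrite (ge0_integral_density hQ); [|exact/measurable_EFinP|by []].
apply: ge0_le_integral => //.
- by move=> z _; rewrite -EFinM lee_fin !mulr_ge0 ?invr_ge0.
- by apply: emeasurable_funM => //; exact/measurable_EFinP.
- by apply: emeasurable_funM; exact/measurable_EFinP.
- move=> z _; rewrite -!EFinM lee_fin.
  have [->|pz] := eqVneq (p z) 0%R; first by rewrite mulr0 mulr_ge0.
  by rewrite -mulrA divfK.
Qed.

End density.

(** * From finite extended integrals to integrable real logarithms *)

Section integrability.
Context (d : measure_display) (Z : measurableType d) (R : realType).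
Implicit Types (mu : {measure set Z -> \bar R}) (f g : Z -> \bar R)
  (p : Z -> R).

Lemma fin_num_integrable mu f : measurable_fun setT f ->
  \int[mu]_z f z \is a fin_num -> mu.-integrable setT f.
Proof.
move=> mf; rewrite fin_num_abs => ffin; apply/integrableP; split=> //.
exact/abse_integralP.
Qed.

Lemma ae_eq_integrable mu f g : measurable_fun setT g ->
  {ae mu, forall z, f z = g z} -> mu.-integrable setT f ->
  mu.-integrable setT g.
Proof.
move=> mg fg /integrableP[mf foo]; apply/integrableP; split=> //.
rewrite (le_lt_trans _ foo)// le_eqVlt; apply/orP; left; apply/eqP.
apply: ge0_ae_eq_integral => //; try exact: measurableT_comp.
by apply: filterS fg => z -> _.
Qed.

Lemma measurable_lne p : measurable_fun setT p ->
  measurable_fun setT (fun z => lne (p z)%:E).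
Proof.
move=> mp; apply: measurable_fun_ifT => //; first exact: measurable_fun_ler.
by apply/measurable_EFinP; apply: measurableT_comp => //; exact: measurable_ln.
Qed.

(** An integrable function is finite almost everywhere, which excludes [p = 0], where [lne] is -oo.
    So the real-valued [ln] may replace [lne]. *)
Lemma integrable_lne mu p : measurable_fun setT p ->
  mu.-integrable setT (fun z => lne (p z)%:E) ->
  [/\ {ae mu, forall z, (0 < p z)%R},
      mu.-integrable setT (fun z => (ln (p z))%:E) &
      \int[mu]_z lne (p z)%:E = \int[mu]_z (ln (p z))%:E].
Proof.
move=> mp ip; have mlnp : measurable_fun setT (fun z => (ln (p z))%:E).
  by apply/measurable_EFinP; apply: measurableT_comp => //; exact: measurable_ln.
have p_gt0 : {ae mu, forall z, (0 < p z)%R}.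
  apply: filterS (integrable_ae measurableT ip) => z /(_ I).
  by rewrite /=; case: ifPn => //; rewrite ltNge.
have ln_eq : {ae mu, forall z, lne (p z)%:E = (ln (p z))%:E}.
  by apply: filterS p_gt0 => z; exact: lne_EFin.
split=> //; first exact: ae_eq_integrable ln_eq ip.
apply: ae_eq_integral => //; first exact: measurable_lne.
by apply: filterS ln_eq => z -> _.
Qed.

End integrability.

(** * Donsker-Varadhan inequality and finiteness of the divergence *)

Section relative_entropy.
Context (d : measure_display) (Z : measurableType d) (R : realType).
Implicit Types (mu : {measure set Z -> \bar R}) (P Q : probability Z R)
  (p q f : Z -> R).

Lemma integral_probability_cst P (k : \bar R) : \int[P]__ k = k.
Proof.
rewrite integral_cst// -[RHS]mule1; congr (_ * _).
exact: probability_setT.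
Qed.

(** An upper bound [c] stands in for the log-moment of [f] under [Q], so no logarithm of a possibly
    infinite integral appears. Absolute continuity of [P] enters as [q > 0] almost everywhere. *)
Lemma donsker_varadhan mu P Q p q f (c : R) :
  is_density mu P p -> is_density mu Q q -> measurable_fun setT f ->
  {ae P, forall z, (0 < q z)%R} ->
  P.-integrable setT (fun z => (f z)%:E) ->
  P.-integrable setT (fun z => (ln (p z) - ln (q z))%:E) ->
  \int[Q]_z (expR (f z))%:E <= (expR c)%:E ->
  \int[P]_z (f z)%:E <= \int[P]_z (ln (p z) - ln (q z))%:E + c%:E.
Proof.
move=> hP hQ mf q_gt0 intf intL fc.
have [[mp p0 _] [mq q0 _]] := (hP, hQ).
have intc k : P.-integrable setT (cst k%:E) by exact: finite_measure_integrable_cst.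
pose L z := (ln (p z) - ln (q z))%R.
(* Integrate 1 + u <= exp u, where exp u = exp (f - c) q / p P-a.e. *)
pose u z := (f z - L z - c)%R.
have mL : measurable_fun setT L.
  by apply: measurable_funB; apply: measurableT_comp => //; exact: measurable_ln.
have m_u : measurable_fun setT u.
  by apply: measurable_funB => //; exact: measurable_funB.
have mexp (h : Z -> R) : measurable_fun setT h ->
    measurable_fun setT (fun z => (expR (h z))%:E).
  move=> mh; apply/measurable_EFinP.
  exact: measurableT_comp (@measurable_expR R) mh.
have mfc : measurable_fun setT (fun z => expR (f z - c)).
  apply: measurableT_comp (@measurable_expR R) _.
  exact: measurable_funB.
have int_exp : \int[P]_z (expR (u z))%:E <= 1.
  have mr := measurable_fun_ratio p0 mq mp.
  have -> : \int[P]_z (expR (u z))%:E =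
      \int[P]_z (expR (f z - c) * (q z / p z))%:E.
    apply: ge0_ae_eq_integral => //.
    - exact: mexp.
    - exact/measurable_EFinP/measurable_funM.
    - by move=> z _; rewrite lee_fin mulr_ge0 ?expR_ge0 ?divr_ge0.
    - apply: filterS2 (density_gt0_ae hP) q_gt0 => z pz qz _; congr _%:E.
      rewrite /u /L -[q z in RHS]lnK ?posrE//.
      rewrite -[p z in RHS]lnK ?posrE// -expRB -expRD; congr expR; ring.
  (* The ratio [q / p] turns the integral under [P] into one under [Q], where [fc] bounds the moment
     by [expR c]. *)
  apply: (le_trans (integral_density_ratio_le hP hQ _ _)) => //.
  under eq_integral do rewrite expRB EFinM muleC.
  rewrite ge0_integralZl//.
  - rewrite (le_trans (lee_wpmul2l _ fc)) ?lee_fin ?invr_ge0 ?expR_ge0//.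
    by rewrite mulVf ?gt_eqF ?expR_gt0.
  - exact: mexp.
have intu : P.-integrable setT (fun z => (u z)%:E).
  exact: (integrableB measurableT (integrableB measurableT intf intL) (intc c)).
have int_expu : P.-integrable setT (fun z => (expR (u z))%:E).
  apply/integrableP; split; first exact: mexp.
  rewrite (le_lt_trans _ (ltry 1%R))// (le_trans _ int_exp)//.
  apply: ge0_le_integral => //.
  - by apply: measurableT_comp => //; exact: mexp.
  - exact: mexp.
  - by move=> z _; rewrite /= ger0_norm ?expR_ge0.
have : \int[P]_z ((u z)%:E + 1) <= 1.
  apply: le_trans int_exp; apply: le_integral => //.
    exact: (integrableD measurableT intu (intc 1%R)).
  by move=> z _; rewrite -EFinD lee_fin addrC expR_ge1Dx.
rewrite (integralD measurableT intu (intc 1%R)).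
rewrite (integralB measurableT (integrableB measurableT intf intL) (intc c)).
rewrite (integralB measurableT intf intL) !integral_probability_cst.
have := integrable_fin_num measurableT intf.
have := integrable_fin_num measurableT intL.
rewrite -/L; do 2 move=> /fineK <-.
by rewrite -!EFinB -!EFinD !lee_fin; lra.
Qed.

(** The extended inverse of 0 is +oo and 0 * +oo = 0, so at 0 / 0 the case [p = 0] prevails. The
    case form also yields measurability. *)
Lemma KL_integrandE p q z : (0 <= p z)%R -> (0 <= q z)%R ->
  lne ((p z)%:E / (q z)%:E) =
  if (p z <= 0)%R then -oo else
  if (q z <= 0)%R then +oo else (ln (p z) - ln (q z))%:E.
Proof.
move=> p0 q0; have [pz|pz] := leP (p z) 0%R.
  have -> : p z = 0%R by apply/eqP; rewrite eq_le pz.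
  by rewrite mul0e/= lexx.
have [qz|qz] := leP (q z) 0%R.
  have -> : q z = 0%R by apply/eqP; rewrite eq_le qz.
  by rewrite inve0 gt0_muley.
rewrite inver gt_eqF// -EFinM lne_EFin ?divr_gt0//.
by rewrite ln_div// posrE.
Qed.

Lemma measurable_KL_integrand p q :
  measurable_fun setT p -> measurable_fun setT q ->
  (forall z, 0 <= p z)%R -> (forall z, 0 <= q z)%R ->
  measurable_fun setT (fun z => lne ((p z)%:E / (q z)%:E)).
Proof.
move=> mp mq p0 q0; under eq_fun do rewrite KL_integrandE//.
apply: measurable_fun_ifT => //; first exact: measurable_fun_ler.
apply: measurable_fun_ifT => //; first exact: measurable_fun_ler.
apply/measurable_EFinP; apply: measurable_funB.
  by apply: measurableT_comp => //; exact: measurable_ln.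
by apply: measurableT_comp => //; exact: measurable_ln.
Qed.

(* The negative part of log (p / q) is dominated by q / p, which has P-mass at
   most 1; so the integral defining the divergence is never oo - oo. *)
Lemma KL_gtNy mu P Q p q : is_density mu P p -> is_density mu Q q ->
  -oo < KL P p q.
Proof.
move=> hP hQ; have [[mp p0 _] [mq q0 _]] := (hP, hQ).
have mKL := measurable_KL_integrand mp mq p0 q0.
pose F z := lne ((p z)%:E / (q z)%:E).
have neg_le1 : \int[P]_z F^\- z <= 1.
  have := integral_density_ratio_le (g := cst 1%R) hP hQ (measurable_cst _)
    (fun=> ler01).
  rewrite (integral_probability_cst Q 1); apply: le_trans.
  apply: ae_ge0_le_integral => //.
  - exact: measurable_funeneg.
  - by move=> z _; rewrite lee_fin mul1r divr_ge0.
  - by apply/measurable_EFinP/measurable_funM => //; exact: measurable_fun_ratio.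
  (* For [p > 0]: if [q = 0] the integrand is +oo and its negative part is 0; otherwise use ln (q /
     p) <= q / p. *)
  - apply: filterS (density_gt0_ae hP) => z pz _.
    rewrite mul1r funenegE /F KL_integrandE// [(p z <= 0)%R]leNgt pz/= ge_max.
    rewrite lee_fin divr_ge0// andbT.
    have [_|qz] := leP (q z) 0%R; first by rewrite leNye.
    rewrite -EFinN lee_fin opprB -ln_div ?posrE//.
    by rewrite ltW// ln_sublinear// divr_gt0.
rewrite /KL integralE (@lt_le_trans _ _ (0 - 1))//; last first.
  by apply: leeB => //; exact: integral_ge0.
by rewrite sub0e ltNyr.
Qed.

(** A finite divergence makes the integrand finite [P]-almost everywhere. As [q = 0 < p] would give
    +oo, this yields absolute continuity. *)
Lemma KL_fin_num mu P Q p q : is_density mu P p -> is_density mu Q q ->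
  KL P p q \is a fin_num ->
  [/\ {ae P, forall z, (0 < q z)%R},
      P.-integrable setT (fun z => (ln (p z) - ln (q z))%:E) &
      KL P p q = \int[P]_z (ln (p z) - ln (q z))%:E].
Proof.
move=> hP hQ; have [[mp p0 _] [mq q0 _]] := (hP, hQ).
have mKL := measurable_KL_integrand mp mq p0 q0 => KLfin.
have iKL := fin_num_integrable mKL KLfin.
have mL : measurable_fun setT (fun z => (ln (p z) - ln (q z))%:E).
  apply/measurable_EFinP; apply: measurable_funB;
    by apply: measurableT_comp => //; exact: measurable_ln.
have q_gt0 : {ae P, forall z, (0 < q z)%R}.
  apply: filterS2 (density_gt0_ae hP) (integrable_ae measurableT iKL).
  move=> z pz /(_ I); rewrite KL_integrandE// leNgt pz/=.
  by case: ifPn => //; rewrite ltNge.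
have KL_eq : {ae P, forall z,
    lne ((p z)%:E / (q z)%:E) = (ln (p z) - ln (q z))%:E}.
  apply: filterS2 (density_gt0_ae hP) q_gt0 => z pz qz.
  by rewrite KL_integrandE// !leNgt pz qz.
split=> //; first exact: ae_eq_integrable KL_eq iKL.
by apply: ae_eq_integral => //; apply: filterS KL_eq => z -> _.
Qed.

(** Donsker-Varadhan with the zero test function. Stated for the real log-ratio, it also applies
    with [P] and [Q] exchanged, without finiteness of [KL] as input. *)
Lemma gibbs mu P Q p q : is_density mu P p -> is_density mu Q q ->
  {ae P, forall z, (0 < q z)%R} ->
  P.-integrable setT (fun z => (ln (p z) - ln (q z))%:E) ->
  0 <= \int[P]_z (ln (p z) - ln (q z))%:E.
Proof.
move=> hP hQ q_gt0 iL.
have := donsker_varadhan (f := cst 0%R) (c := 0%R) hP hQ (measurable_cst _)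
  q_gt0 (finite_measure_integrable_cst _ _ measurableT) iL.
rewrite (integral_probability_cst P 0) adde0; apply.
by rewrite (integral_probability_cst Q (expR 0)%:E).
Qed.

End relative_entropy.

(** * Optimising over the parameter [l] *)

Lemma le_sqrt_quadratic (R : realType) (A K s : R) : (0 < s)%R ->
  (forall l, 0 < l -> l * A <= K + l ^+ 2 * s ^+ 2 / 2)%R ->
  (A <= Num.sqrt (2 * s ^+ 2 * K))%R.
Proof.
move=> s0 H; have [A0|A0] := leP A 0%R; first exact: le_trans A0 (sqrtr_ge0 _).
have s2 : (0 < s ^+ 2)%R by rewrite exprn_gt0.
(* With l = A / s^2 and after scaling by s^2, the hypothesis reads A^2 <= s^2 K + A^2 / 2. *)
have := H (A / s ^+ 2)%R (divr_gt0 A0 s2).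
rewrite -(ler_pM2l s2) => HA.
rewrite -[leLHS](ger0_norm (ltW A0)) -sqrtr_sqr; apply: ler_wsqrtr.
have e1 : (s ^+ 2 * (A / s ^+ 2 * A) = A ^+ 2)%R by field; rewrite gt_eqF.
have e2 : (s ^+ 2 * (K + (A / s ^+ 2) ^+ 2 * s ^+ 2 / 2) =
  s ^+ 2 * K + A ^+ 2 / 2)%R by field; rewrite gt_eqF.
by move: HA; rewrite e1 e2; lra.
Qed.

(** * Transport inequality and exponential moments from Rényi terms *)

Section renyi_bound.
Context (d : measure_display) (Z : measurableType d) (R : realType).
Implicit Types (mu : {measure set Z -> \bar R}) (P Q : probability Z R)
  (p q t : Z -> R).

(** Common core of both directions, used with [t] equal to -ln q and to ln p, and [h] the [Q]-mean
    of [t]. Donsker-Varadhan for [l * t] gives l (E_P t - h) <= D(P||Q) + l^2 s^2 / 2. *)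
Lemma subgaussian_transport mu P Q p q t (h s : R) :
  is_density mu P p -> is_density mu Q q -> KL P p q \is a fin_num ->
  (0 < s)%R -> P.-integrable setT (fun z => (t z)%:E) ->
  (forall l, (0 < l)%R -> \int[Q]_z (expR (l * t z))%:E <=
    (expR (l * (h + l * s ^+ 2 / 2)))%:E) ->
  \int[P]_z (t z)%:E - h%:E <= sqrte ((2 * s ^+ 2)%:E * KL P p q).
Proof.
move=> hP hQ KLfin s0 it Ht; have [q_gt0 iL KLE] := KL_fin_num hP hQ KLfin.
have tfin := integrable_fin_num measurableT it.
have mt : measurable_fun setT t.
  by apply/measurable_EFinP; case/integrableP : it.
rewrite -(fineK KLfin) -(fineK tfin) -EFinM -EFinB /= lee_fin.
apply: le_sqrt_quadratic => // l l0.
have ilt : P.-integrable setT (fun z => (l * t z)%:E).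
  exact: (integrableZl measurableT l it).
have := donsker_varadhan hP hQ (measurable_funM (measurable_cst l) mt)
  q_gt0 ilt iL (Ht l l0).
have -> : \int[P]_z (l * t z)%:E = l%:E * \int[P]_z (t z)%:E.
  exact: (integralZl measurableT it l).
rewrite -KLE -(fineK KLfin) -(fineK tfin) -EFinM -EFinD lee_fin.
lra.
Qed.

Lemma epowE (x r : R) :
  epow x%:E r = if (x <= 0)%R then expeR (r%:E * -oo) else
                (expR (r * ln x))%:E.
Proof. by rewrite /epow /=; case: ifPn. Qed.

(** When [p] vanishes only on a [Q]-null set, the value of [epow] at 0 does not affect the integral,
    and the Rényi integral is an exponential moment of ln p. *)
Lemma integral_epow Q p r : measurable_fun setT p ->
  {ae Q, forall z, (0 < p z)%R} ->
  \int[Q]_z epow (p z)%:E r = \int[Q]_z (expR (r * ln (p z)))%:E.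
Proof.
move=> mp p_gt0.
have mexp : measurable_fun setT (fun z => (expR (r * ln (p z)))%:E).
  apply/measurable_EFinP; apply: measurableT_comp (@measurable_expR R) _.
  apply: measurable_funM => //.
  exact: measurableT_comp (@measurable_ln R) mp.
under eq_integral do rewrite epowE.
apply: ae_eq_integral => //.
  by apply: measurable_fun_ifT => //; exact: measurable_fun_ler.
by apply: filterS p_gt0 => z pz _; rewrite leNgt pz.
Qed.

Lemma lne_bound_expR (x : \bar R) (l h b : R) : (0 < l)%R -> 0 <= x ->
  (l^-1)%:E * lne x - h%:E <= b%:E -> x <= (expR (l * (h + b)))%:E.
Proof.
(* For [x] = +oo the left side would be +oo, contradicting the finite bound: a bounded Rényi
   difference includes finiteness of the moment. *)
move=> l0; case: x => [r _|_|//]; last first.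
  by rewrite gt0_muley ?lte_fin ?invr_gt0.
have [r0 _|r0] := leP r 0%R; first by rewrite lee_fin (le_trans r0)// expR_ge0.
rewrite lne_EFin// -EFinM -EFinB !lee_fin lerBlDl => H.
by rewrite -[leLHS]lnK ?posrE// ler_expR -ler_pdivrMl.
Qed.

Lemma Hlog_integrable_lne P p : measurable_fun setT p ->
  Hlog P p \is a fin_num -> P.-integrable setT (fun z => lne (p z)%:E).
Proof.
move=> mp Hfin.
have iN : P.-integrable setT (fun z => - lne (p z)%:E).
  apply: fin_num_integrable => //.
  by apply: measurableT_comp => //; exact: measurable_lne.
by apply: eq_integrable (integrableN iN) => // z _; rewrite /= oppeK.
Qed.

(** The sides differ only in whether the sign is inside the integral; finiteness rules out oo - oo
    when it is moved. *)
Lemma renyi_entropy1 P p : measurable_fun setT p ->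
  Hlog P p \is a fin_num -> renyi_entropy 1 P p = Hlog P p.
Proof.
move=> mp Hfin; rewrite /renyi_entropy /renyi_cross_entropy eqxx /Hlog.
by rewrite integralN//; apply/integrable_add_def/Hlog_integrable_lne.
Qed.

Lemma Hlog_fin_num P p : measurable_fun setT p -> Hlog P p \is a fin_num ->
  [/\ {ae P, forall z, (0 < p z)%R},
      P.-integrable setT (fun z => (ln (p z))%:E) &
      Hlog P p = - \int[P]_z (ln (p z))%:E].
Proof.
move=> mp Hfin.
have [p_gt0 il lnE] := integrable_lne mp (Hlog_integrable_lne mp Hfin).
split => //; rewrite -renyi_entropy1// /renyi_entropy /renyi_cross_entropy.
by rewrite eqxx lnE.
Qed.

End renyi_bound.

(** * Entropy differences bounded by the divergence *)

Theorem corollary6 (R : realType) (d : measure_display) (Z : measurableType d)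
    (mu : {measure set Z -> \bar R}) (P Q : probability Z R) (p q : Z -> R)
    (hP : is_density mu P p) (hQ : is_density mu Q q)
    (HP_fin : Hlog P p \is a fin_num) (HQ_fin : Hlog Q q \is a fin_num) :
  (forall sigmaQ : R, (0 < sigmaQ)%R ->
    (forall lambda : R, (0 < lambda)%R ->
      renyi_entropy (1 - lambda)%R Q q - renyi_entropy 1%R Q q
        <= (lambda * sigmaQ ^+ 2 / 2)%:E) ->
    Hlog P p - Hlog Q q <= sqrte ((2 * sigmaQ ^+ 2)%:E * KL P p q))
  /\
  (renyi_cross_entropy 1%R Q p \is a fin_num ->
   forall sigmaP : R, (0 < sigmaP)%R ->
    (forall lambda : R, (0 < lambda)%R ->
      renyi_cross_entropy 1%R Q p - renyi_cross_entropy (1 + lambda)%R Q p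
        <= (lambda * sigmaP ^+ 2 / 2)%:E) ->
    Hlog Q q - Hlog P p <= sqrte ((2 * sigmaP ^+ 2)%:E * KL P p q)).
Proof.
have [[mp p0 _] [mq q0 _]] := (hP, hQ).
have [p_gt0 ilnp HPE] := Hlog_fin_num mp HP_fin.
have [q_gt0 ilnq HQE] := Hlog_fin_num mq HQ_fin.
(* Reduction to a finite divergence: at +oo the right side is +oo, and -oo is excluded by
   [KL_gtNy]. *)
have KLy (s : R) (B : \bar R) : (0 < s)%R ->
    (KL P p q \is a fin_num -> B <= sqrte ((2 * s ^+ 2)%:E * KL P p q)) ->
    B <= sqrte ((2 * s ^+ 2)%:E * KL P p q).
  move=> s0 HB; have := KL_gtNy hP hQ; move: HB; case: (KL P p q) => // [r|].
    by move=> + _; exact.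
  move=> _ _; rewrite gt0_muley ?leey//.
  by rewrite lte_fin mulr_gt0// exprn_gt0.
split=> [s s0 Hs|R1fin s s0 Hs]; apply: KLy => // KLfin;
  have [q_gt0P iL KLE] := KL_fin_num hP hQ KLfin.
(* -ln q = (ln p - ln q) - ln p, a difference of functions integrable under [P]. *)
- have it : P.-integrable setT (fun z => (- ln (q z))%:E).
    apply: eq_integrable (integrableB measurableT iL ilnp) => // z _ /=.
    by rewrite -EFinB; congr _%:E; ring.
  have tE : \int[P]_z (- ln (q z))%:E = KL P p q + Hlog P p.
    rewrite KLE HPE -(integralB measurableT iL ilnp).
    by apply: eq_integral => z _; rewrite /= -EFinB; congr _%:E; ring.
  have KL0 : 0 <= KL P p q by rewrite KLE; exact: gibbs hP hQ q_gt0P iL.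
  (* The transport bound controls D(P||Q) + H(P) - H(Q); the divergence is dropped as
     nonnegative. *)
  apply: (@le_trans _ _
      (\int[P]_z (- ln (q z))%:E - (fine (Hlog Q q))%:E)).
    by rewrite fineK// leeB// tE leeDr.
  apply: (subgaussian_transport hP hQ KLfin s0 it) => l l0.
  have -> : \int[Q]_z (expR (l * - ln (q z)))%:E =
      \int[Q]_z epow (q z)%:E (- l).
    rewrite integral_epow//.
    by apply: eq_integral => z _; rewrite mulrN mulNr.
  apply: lne_bound_expR => //.
    by apply: integral_ge0 => z _; exact: expeR_ge0.
  rewrite fineK//; have := Hs l l0; rewrite renyi_entropy1//.
  (* Order 1 - l gives the prefactor 1 / l and the exponent -l. *)
  rewrite /renyi_entropy /renyi_cross_entropy ifF; last first.
    by apply/negbTE; rewrite subr_eq addrC -subr_eq subrr lt_eqF.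
  by rewrite subKr addrAC subrr add0r mulrAC.
- have [p_gt0Q ilnpQ R1E] : [/\ {ae Q, forall z, (0 < p z)%R},
      Q.-integrable setT (fun z => (ln (p z))%:E) &
      renyi_cross_entropy 1 Q p = - \int[Q]_z (ln (p z))%:E].
    move: R1fin; rewrite /renyi_cross_entropy eqxx fin_numN.
    move=> /(fin_num_integrable (measurable_lne mp)).
    by move=> /(integrable_lne mp)[? ? ->].
  have hfin := integrable_fin_num measurableT ilnpQ.
  (* Gibbs with the roles exchanged gives H(Q) <= R_1(Q,P); finiteness of R_1(Q,P) supplied [p > 0]
     almost everywhere under [Q]. *)
  have : 0 <= \int[Q]_z (ln (q z) - ln (p z))%:E.
    by apply: (gibbs hQ hP p_gt0Q); exact: (integrableB measurableT ilnq ilnpQ).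
  rewrite (integralB measurableT ilnq ilnpQ) => Gibbs.
  apply: (@le_trans _ _
      (\int[P]_z (ln (p z))%:E - (fine (\int[Q]_z (ln (p z))%:E))%:E)).
    rewrite HQE HPE oppeK addeC fineK//; apply: leeD2r; rewrite leeN2.
    by rewrite -sube_ge0 ?hfin.
  apply: (subgaussian_transport hP hQ KLfin s0 ilnp) => l l0.
  rewrite -integral_epow//.
  apply: lne_bound_expR => //.
    by apply: integral_ge0 => z _; exact: expeR_ge0.
  rewrite fineK//; have := Hs l l0; rewrite R1E.
  (* Order 1 + l gives the prefactor -1 / l, so the subtracted Rényi term contributes +1 / l times
     the log-moment, while R_1(Q,P) = -h. *)
  rewrite /renyi_cross_entropy ifF; last first.
    by apply/negbTE; rewrite -subr_eq0 addrC addKr gt_eqF.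
  rewrite opprD addrA subrr add0r [(1 + l)%R]addrC addrK invrN EFinN mulNe oppeK.
  by rewrite addeC mulrAC.
Qed.
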